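(* For any ring $R$ the following is always true. (1) There is no idempotent element other than zero in $P_R$. (2) Every element of $P_R$ is a nilpotent element. (3) Every element of $P_R$ is a zero divisor element.
   Context: Rings are associative, not necessarily commutative and not necessarily with identity. For a ring $R$ and $a\in R$, put $S_R^a=\{b\in R \mid aRb=(0)\}$, where $aRb=(0)$ means $acb=0$ for all $c\in R$. The source of primeness of $R$ is $P_R=\bigcap_{a\in R}S_R^a$. An element $e\in R$ is idempotent if $e^2=e$, and $a\in R$ is nilpotent if $a^n=0$ for some positive integer $n$. An element $a\in R$ is a right (resp. left) zero-divisor if there exists a nonzero $b\in R$ with $ba=0$ (resp. $ab=0$); $a$ is called a zero divisor if it is both a left and a right zero-divisor.
   Formalization: Part (3) is stated only for rings with a nonzero element: in the zero ring, 0 lies in P_R but is not a zero divisor, since no nonzero b exists. *)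

(* Defs.v *)
From HB Require Import structures.
From mathcomp Require Import all_boot all_algebra.
From mathcomp Require Import classical_sets.

Set Implicit Arguments.
Unset Strict Implicit.
Unset Printing Implicit Defensive.

(* [*] is the semigroup product of group_scope; [+] and [0] come from
   ring_scope. *)
Local Open Scope ring_scope.
Local Open Scope group_scope.
Local Open Scope classical_set_scope.

(* MathComp's rings are unital, so rings without identity are built here as
   an abelian group and a semigroup on the same carrier, linked by
   distributivity. Neither a unit nor [0 != 1] is assumed, and the zero ring
   is allowed. *)
HB.mixin Record Zmodule_Semigroup_isRng R
    of GRing.Zmodule R & Semigroup R := {
  rng_mulDl : left_distributive ( *%g : R -> R -> R) +%R;
  rng_mulDr : right_distributive ( *%g : R -> R -> R) +%R
}.

#[short(type="rngType")]
HB.structure Definition Rng :=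
  {R of Zmodule_Semigroup_isRng R & GRing.Zmodule R & Semigroup R}.

Definition annihilated_by (R : rngType) (a : R) : set R :=
  [set b | forall c : R, a * c * b = 0].

Definition source_of_primeness (R : rngType) : set R :=
  \bigcap_(a in [set: R]) annihilated_by a.

Arguments source_of_primeness : clear implicits.

Definition idempotent_elt (R : rngType) (e : R) : Prop := e * e = e.

(* [pow_succ a n] is a ^ (n + 1): without an identity only positive powers
   make sense. *)
Definition pow_succ (R : rngType) (a : R) (n : nat) : R :=
  iter n (fun x => x * a) a.

Definition nilpotent_elt (R : rngType) (a : R) : Prop :=
  exists n : nat, pow_succ a n = 0.

Definition right_zero_divisor (R : rngType) (a : R) : Prop :=
  exists2 b : R, b <> 0 & b * a = 0.

Definition left_zero_divisor (R : rngType) (a : R) : Prop :=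
  exists2 b : R, b <> 0 & a * b = 0.

Definition zero_divisor (R : rngType) (a : R) : Prop :=
  left_zero_divisor a /\ right_zero_divisor a.

(* Main.v *)
Require Import Defs.
From mathcomp Require Import all_boot all_algebra.
From mathcomp Require Import classical_sets.

Local Open Scope ring_scope.
Local Open Scope classical_set_scope.

(** An element [b] of the source of primeness satisfies [a * c * b = 0] for
    all [a] and [c]; with [a = c = b] this gives [b ^ 3 = 0]
    ([source_of_primeness_cube]). An idempotent equals its cube, so the only
    idempotent in the source is [0], and every element of the source is
    nilpotent. In a nonzero ring a nilpotent element is a two-sided zero
    divisor, as its last nonzero power shows
    ([nilpotent_zero_divisor]). The zero ring has no zero divisors at all in
    the present sense, whence the hypothesis that a nonzero element exists. *)

Lemma rng_mul0 (R : rngType) (x : R) : (0 * x)%g = 0 :> R.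
Proof.
by apply: (GRing.addrI (0 * x)%g); rewrite -rng_mulDl !GRing.addr0.
Qed.

Lemma rng_mulr0 (R : rngType) (x : R) : (x * 0)%g = 0 :> R.
Proof.
by apply: (GRing.addrI (x * 0)%g); rewrite -rng_mulDr !GRing.addr0.
Qed.

Lemma pow_succ_comm (R : rngType) (a : R) (n : nat) :
  (a * pow_succ a n)%g = (pow_succ a n * a)%g.
Proof. by elim: n => //= n IHn; rewrite mulgA IHn. Qed.

(** For [a <> 0] the witness on both sides is the last nonzero power of [a].
    For [a = 0] no power is nonzero, and any nonzero element of the ring
    serves instead. *)
Lemma nilpotent_zero_divisor (R : rngType) (a : R) :
  (exists x : R, x <> 0) -> nilpotent_elt a -> zero_divisor a.
Proof.
move=> [x x_neq0] [k ak0].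
have ex_k : exists n, pow_succ a n == 0 by exists k; apply/eqP.
case: (ex_minnP ex_k) => -[|m] /eqP am0 min_m.
  rewrite /= in am0; rewrite am0.
  by split; exists x; rewrite ?rng_mul0 ?rng_mulr0.
have pow_neq0 : pow_succ a m <> 0.
  by move=> /eqP/min_m; rewrite ltnn.
by split; exists (pow_succ a m); rewrite ?pow_succ_comm.
Qed.

Lemma source_of_primeness_cube (R : rngType) (a : R) :
  source_of_primeness R a -> (a * a * a)%g = 0 :> R.
Proof. by move=> Pa; apply: (Pa a). Qed.

Theorem corollary2p20 (R : rngType) :
  [/\ forall e : R, source_of_primeness R e -> idempotent_elt e -> e = 0,
      forall a : R, source_of_primeness R a -> nilpotent_elt a
    & (exists x : R, x <> 0) ->
      forall a : R, source_of_primeness R a -> zero_divisor a].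
Proof.
have source_nilpotent (a : R) : source_of_primeness R a -> nilpotent_elt a.
  (* [pow_succ a 2] is the cube of [a]. *)
  by move=> /source_of_primeness_cube a3; exists 2%N.
split=> [e Pe ee | // | R_neq0 a /source_nilpotent].
  by rewrite -(source_of_primeness_cube _ _ Pe) !ee.
exact: nilpotent_zero_divisor.
Qed.
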